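(* (1) The $\mathfrak{sl}(2)$-weight system does not extend to a 4-invariant of graphs: there is no 4-invariant $g\colon\mathbb{G}\to\mathbb{C}[c]$ such that $g(\Gamma_D)=w_{\mathfrak{sl}(2)}(D)$ for every chord diagram $D$. In other words, the question whether there exists a unique 4-invariant of graphs extending the $\mathfrak{sl}(2)$-weight system has a negative answer, and even when the values of a weight system are determined by the intersection graphs of chord diagrams, the weight system is not necessarily extendable to a graph 4-invariant. (2) It is only possible for specializations of the $\mathfrak{sl}(2)$-weight system to extend to 4-invariants of graphs for $c=0,\frac38,1,-\frac{3}{32}$: if $t\in\mathbb{C}$ and there exists a 4-invariant $g\colon\mathbb{G}\to\mathbb{C}$ such that $g(\Gamma_D)=w_{\mathfrak{sl}(2)}(D)|_{c=t}$ for every chord diagram $D$, then $t\in\{0,\frac38,1,-\frac{3}{32}\}$.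
   Context: Chord diagrams. A chord diagram of order $n\ge 0$ is a set of $2n$ pairwise distinct points on an oriented circle together with a complete pairing of these points (the pairs are called chords), considered up to orientation-preserving diffeomorphism of the circle. $\mathbb{A}$ is the complex vector space freely spanned by all chord diagrams. Two chords intersect if their endpoints interlace on the circle. The intersection graph $\Gamma_D$ of a chord diagram $D$ has the chords of $D$ as vertices, two vertices being adjacent iff the chords intersect. Weight systems. A linear map $w\colon\mathbb{A}\to M$ to a complex vector space is a weight system if for every chord diagram with a chosen chord with endpoints $p,q$ and a chosen second chord with one fixed endpoint $r$, one has $w(D_{q^+})-w(D_{q^-})+w(D_{p^+})-w(D_{p^-})=0$, where $D_{s^\pm}$ is the diagram in which the other endpoint of the second chord is placed immediately after ($+$) or immediately before ($-$) the point $s$ on the circle, all other chords being the same (4T-relations; the 1T-relations are not imposed). The $\mathfrak{sl}(2)$-weight system $w_{\mathfrak{sl}(2)}\colon\mathbb{A}\to\mathbb{C}[c]$ is the weight system associated with the Lie algebra $\mathfrak{sl}(2)$ with its Killing form, $c$ being the Casimir element. It is well defined and uniquely determined (Chmutov–Varchenko) by: its value on the diagram with no chords is $1$, and for every chord diagram $D$ and every chord $a$ of $D$ intersecting exactly $k$ other chords $a_1,\dots,a_k$, $$w_{\mathfrak{sl}(2)}(D)=\Bigl(c-\frac k2\Bigr)w_{\mathfrak{sl}(2)}(D_a)+\frac12\sum_{1\le i<j\le k}\bigl(w_{\mathfrak{sl}(2)}(D''_{i,j})-w_{\mathfrak{sl}(2)}(D^{\times}_{i,j})\bigr).$$ Here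 $D_a$ is $D$ with $a$ deleted. The endpoints of $a$ split the circle into two open arcs, and each $a_i$ has one endpoint $p_i$ on the first arc and one endpoint $p_i^*$ on the second; $D''_{i,j}$ (resp. $D^\times_{i,j}$) is obtained from $D$ by deleting $a$ and replacing $a_i,a_j$ by the chords $\{p_i,p_j\},\{p_i^*,p_j^*\}$ (resp. $\{p_i,p_j^*\},\{p_i^*,p_j\}$). It is known (Chmutov–Lando) that $w_{\mathfrak{sl}(2)}(D)$ depends only on $\Gamma_D$. Graphs. All graphs are finite and simple, considered up to isomorphism; $\mathbb{G}$ is the complex vector space freely spanned by isomorphism classes of graphs. A linear map $g\colon\mathbb{G}\to M$ to a complex vector space is a 4-invariant if for every graph $G$ and every ordered pair $(a,b)$ of adjacent vertices of $G$, $$g(G)-g(G'_{ab})=g(\widetilde G_{ab})-g(\widetilde G'_{ab}),$$ where $G'_{ab}$ is $G$ with the edge $ab$ removed; $\widetilde G_{ab}$ is obtained from $G$ by switching the adjacency of $a$ with every vertex $v\ne a,b$ that is adjacent to $b$ (so the set of neighbours of $a$ outside $\{a,b\}$ is replaced by its symmetric difference with the set of neighbours of $b$ outside $\{a,b\}$), everything else (including the edge $ab$) being kept; and $\widetilde G'_{ab}$ is $\widetilde G_{ab}$ with the edge $ab$ removed. *)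

(* Defs.v *)
From HB Require Import structures.
From mathcomp Require Import all_boot all_order all_algebra.
From mathcomp Require Import generic_quotient.
From mathcomp Require Import boolp reals.
From mathcomp Require Import complex freeg.
From mathcomp Require Import zify.

Set Implicit Arguments.
Unset Strict Implicit.
Unset Printing Implicit Defensive.

Import GRing.Theory.
Local Open Scope ring_scope.
Local Open Scope quotient_scope.
Local Open Scope complex_scope.

(** A chord diagram of order [n] is encoded by a word of length [2n] in which
    every letter occurs exactly twice: cut the circle at a point that is not an
    endpoint, read the [2n] endpoints along the orientation, and write for each
    one the name of its chord. *)
Definition double_occurrence (s : seq nat) : bool :=
  all (fun x => count_mem x s == 2%N) s.

Record chord_word := ChordWord {
  letters :> seq nat;
  _ : double_occurrence letters
}.

HB.instance Definition _ := [isSub for letters].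
HB.instance Definition _ := [Choice of chord_word by <:].

Lemma chord_wordP (D : chord_word) : double_occurrence D.
Proof. by case: D. Qed.

Lemma double_occurrence_count s x :
  double_occurrence s -> count_mem x s = if x \in s then 2%N else 0%N.
Proof.
move=> /allP ds; case: ifP => [/ds/eqP //|/negbT xs].
by apply/count_memPn.
Qed.

(** Moving the cut point rotates the word; renaming the chords is an injective
    relabelling. *)
Definition same_diagram (D E : chord_word) : bool :=
  `[< exists k (f : nat -> nat),
        {in letters D &, injective f} /\ letters E = map f (rot k D) >].

Lemma same_diagram_refl : reflexive same_diagram.
Proof.
by move=> D; apply/asboolP; exists 0%N, id; split=> //; rewrite rot0 map_id.
Qed.

Lemma same_diagram_sym : symmetric same_diagram.
Proof.
suff H D E : same_diagram D E -> same_diagram E D.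
  by move=> D E; apply/idP/idP; apply: H.
move=> /asboolP[k [f [fI eE]]]; apply/asboolP.
pose g y := nth 0%N D (index y (map f D)).
have fK : {in letters D, cancel f g}.
  move=> x xD; have fx : f x \in map f D by exact: map_f.
  have iD : (index (f x) (map f D) < size D)%N by rewrite -(size_map f) index_mem.
  by apply: fI => //; rewrite ?mem_nth // -(nth_map 0%N 0%N) // nth_index.
exists (size D - k)%N, g; rewrite eE; split.
  by move=> _ _ /mapP[x + ->] /mapP[y + ->];
     rewrite !mem_rot => xD yD; rewrite !fK // => ->.
rewrite -map_rot -map_comp.
have [kD|Dk] := leqP k (size D).
  have -> : rot (size D - k) (rot k D) = D.
    by rewrite -[X in rot (X - _) _](size_rot k) -/(rotr k _) rotK.
  by rewrite -[LHS]map_id; apply/eq_in_map => x /= /fK ->.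
have -> : (size D - k = 0)%N by apply/eqP; rewrite subn_eq0 ltnW.
rewrite rot0 rot_oversize ?(ltnW Dk) //.
by rewrite -[LHS]map_id; apply/eq_in_map => x /= /fK ->.
Qed.

Lemma same_diagram_trans : transitive same_diagram.
Proof.
move=> E D F /asboolP[k [f [fI eE]]] /asboolP[l [g [gI eF]]]; apply/asboolP.
have [m em] : exists m, rot l (rot k D) = rot m D.
  have [kD|kD] := leqP k (size D); last first.
    by exists l; rewrite (rot_oversize (ltnW kD)).
  have [lD|lD] := leqP l (size D); last first.
    by exists k; rewrite (@rot_oversize _ l) // size_rot ltnW.
  by exists (if (l + k <= size D)%N then l + k else l + k - size D)%N;
     exact: rot_add_mod.
exists m, (g \o f); split.
  move=> x y xD yD /= e; apply: fI => //; apply: gI e; rewrite eE.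
    by rewrite map_f // mem_rot.
  by rewrite map_f // mem_rot.
by rewrite eF eE -map_rot em map_comp.
Qed.

Canonical same_diagram_equiv :=
  EquivRel same_diagram same_diagram_refl same_diagram_sym same_diagram_trans.

Definition chord_diagram := {eq_quot same_diagram}.

(** Two chords intersect when their endpoints alternate along the word. *)
Definition interlaced (s : seq nat) (x y : nat) : bool :=
  let t := [seq z <- s | (z == x) || (z == y)] in
  (x != y) && ((t == [:: x; y; x; y]) || (t == [:: y; x; y; x])).

Lemma interlaced_sym s : symmetric (interlaced s).
Proof.
move=> x y; rewrite /interlaced eq_sym [X in _ && X]orbC.
by rewrite (eq_filter (a2 := fun z => (z == y) || (z == x))) // => z; rewrite orbC.
Qed.

Lemma interlaced_irr s : irreflexive (interlaced s).
Proof. by move=> x; rewrite /interlaced eqxx. Qed.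

Record graph_on (n : nat) := GraphOn {
  adjmx : 'M[bool]_n;
  _ : (adjmx^T == adjmx) && [forall i, ~~ adjmx i i]
}.

HB.instance Definition _ n := [isSub for @adjmx n].
HB.instance Definition _ n := [Choice of graph_on n by <:].

Definition adj n (G : graph_on n) : rel 'I_n := fun x y => adjmx G x y.

Lemma adj_sym n (G : graph_on n) : symmetric (adj G).
Proof.
by case: G => A AP x y; case/andP: (AP) => /eqP eA _; rewrite /adj /= -[in LHS]eA mxE.
Qed.

Lemma adj_irr n (G : graph_on n) : irreflexive (adj G).
Proof. by case: G => A AP x; case/andP: (AP) => _ /forallP hA; apply/negbTE/hA. Qed.

Lemma graph_of_rel_subproof n (e : rel 'I_n)
    (es : symmetric e) (ei : irreflexive e) :
  let A : 'M[bool]_n := \matrix_(i, j) e i j in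
  (A^T == A) && [forall i, ~~ A i i].
Proof.
apply/andP; split; first by apply/eqP/matrixP => i j; rewrite !mxE es.
by apply/forallP => i; rewrite mxE ei.
Qed.

Definition graph_of_rel n (e : rel 'I_n)
    (es : symmetric e) (ei : irreflexive e) : graph_on n :=
  GraphOn (graph_of_rel_subproof es ei).

Lemma adj_graph_of_rel n (e : rel 'I_n) es ei :
  adj (@graph_of_rel n e es ei) =2 e.
Proof. by move=> x y; rewrite /adj /= mxE. Qed.

Definition fgraph := {n : nat & graph_on n}.

HB.instance Definition _ := Choice.on fgraph.

Definition fgraph_of n (G : graph_on n) : fgraph := existT graph_on n G.

Definition isomorphic (G H : fgraph) : bool :=
  `[< exists f : 'I_(tag G) -> 'I_(tag H),
        bijective f /\
        forall x y, adj (tagged H) (f x) (f y) = adj (tagged G) x y >].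

Lemma isomorphic_refl : reflexive isomorphic.
Proof. by move=> G; apply/asboolP; exists id; split=> //; exists id. Qed.

Lemma isomorphic_sym : symmetric isomorphic.
Proof.
suff H G K : isomorphic G K -> isomorphic K G.
  by move=> G K; apply/idP/idP; apply: H.
move=> /asboolP[f [[g fK gK] fE]]; apply/asboolP; exists g.
by split=> [|x y]; [exists f | rewrite -fE !gK].
Qed.

Lemma isomorphic_trans : transitive isomorphic.
Proof.
move=> H G K /asboolP[f [fb fE]] /asboolP[g [gb gE]]; apply/asboolP.
by exists (g \o f); split=> [|x y]; [exact: bij_comp | rewrite /= gE fE].
Qed.

Canonical isomorphic_equiv :=
  EquivRel isomorphic isomorphic_refl isomorphic_sym isomorphic_trans.

Definition graph_class := {eq_quot isomorphic}.

(** The letters of the word, numbered in order of first occurrence, are the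
    vertices. *)
Definition intersection_rel (D : chord_word) : rel 'I_(size (undup D)) :=
  fun i j => interlaced D (nth 0%N (undup D) i) (nth 0%N (undup D) j).

Lemma intersection_rel_sym D : symmetric (@intersection_rel D).
Proof. by move=> i j; exact: interlaced_sym. Qed.

Lemma intersection_rel_irr D : irreflexive (@intersection_rel D).
Proof. by move=> i; exact: interlaced_irr. Qed.

Definition intersection_graph (D : chord_word) : fgraph :=
  fgraph_of (graph_of_rel (@intersection_rel_sym D) (@intersection_rel_irr D)).

Section GraphOperations.
Variables (n : nat) (G : graph_on n) (a b : 'I_n).

Definition del_edge_rel : rel 'I_n := fun x y =>
  adj G x y && ~~ (((x == a) && (y == b)) || ((x == b) && (y == a))).

Lemma del_edge_sym : symmetric del_edge_rel.
Proof.
by move=> x y; rewrite /del_edge_rel adj_sym orbC ![(_ == a) && _]andbC.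
Qed.

Lemma del_edge_irr : irreflexive del_edge_rel.
Proof. by move=> x; rewrite /del_edge_rel adj_irr. Qed.

Definition del_edge : graph_on n := graph_of_rel del_edge_sym del_edge_irr.

Definition switched (v : 'I_n) : bool := [&& v != a, v != b & adj G v b].

Definition slide_rel : rel 'I_n := fun x y =>
  adj G x y (+) (((x == a) && switched y) || ((y == a) && switched x)).

Lemma slide_sym : symmetric slide_rel.
Proof. by move=> x y; rewrite /slide_rel adj_sym orbC. Qed.

Lemma slide_irr : irreflexive slide_rel.
Proof.
by move=> x; rewrite /slide_rel adj_irr orbb /switched; case: (x == a).
Qed.

Definition slide : graph_on n := graph_of_rel slide_sym slide_irr.

End GraphOperations.

Section Invariants.
Variable R : realType.
Local Notation C := R[i].

Definition diagram_space := {freeg chord_diagram / C}.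
Definition graph_space := {freeg graph_class / C}.


Definition diagram_vec (D : chord_word) : diagram_space :=
  << \pi_chord_diagram D >>.

(** The basis vector of the diagram spelled by [s]; the value [0] is never
    reached below, since every word in use has the double occurrence
    property. *)
Definition word_vec (s : seq nat) : diagram_space :=
  oapp diagram_vec 0 (insub s : option chord_word).

Definition graph_vec n (G : graph_on n) : graph_space :=
  << \pi_graph_class (fgraph_of G) >>.

Definition intersection_vec (D : chord_word) : graph_space :=
  << \pi_graph_class (intersection_graph D) >>.

(** The first chord is [a], with [p] the first and [q] the second of its
    occurrences in [a u a v], where the circle is cut just before [p]. The
    second chord is [b]: its fixed endpoint [r] is the only occurrence of [b]
    in [u ++ v], and its other endpoint is inserted next to [q] or [p]. *)
Definition is_weight_system (M : lmodType C)
    (w : {linear diagram_space -> M}) : Prop :=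
  forall (a b : nat) (u v : seq nat),
    double_occurrence (a :: u ++ a :: b :: v) ->
    count_mem b (u ++ v) = 1%N ->
    w (word_vec (a :: u ++ a :: b :: v)) - w (word_vec (a :: u ++ b :: a :: v))
    + w (word_vec (a :: b :: u ++ a :: v)) - w (word_vec (b :: a :: u ++ a :: v))
    = 0.

Definition is_four_invariant (M : lmodType C)
    (g : {linear graph_space -> M}) : Prop :=
  forall n (G : graph_on n) (a b : 'I_n), adj G a b ->
    g (graph_vec G) - g (graph_vec (del_edge G a b))
    = g (graph_vec (slide G a b))
      - g (graph_vec (del_edge (slide G a b) a b)).

(** In a word [a :: u ++ a :: v] the words [u] and [v] list the endpoints on the
    two arcs cut out by the chord [a]; a chord intersects [a] iff it has one
    endpoint on each arc. *)
Definition crossing_chords (a : nat) (u v : seq nat) : seq nat :=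
  [seq b <- undup (u ++ v) | interlaced (a :: u ++ a :: v) a b].

Definition rename (x y : nat) (s : seq nat) : seq nat :=
  [seq if z == x then y else z | z <- s].

Definition swap_letters (x y : nat) (s : seq nat) : seq nat :=
  [seq if z == x then y else if z == y then x else z | z <- s].

(** [x] and [y] cross [a]: the two occurrences [p_x], [p_y] in [u] become one
    chord, and the two occurrences [p_x*], [p_y*] in [v] become the other. *)
Definition parallel_word (x y : nat) (u v : seq nat) : seq nat :=
  rename y x u ++ rename x y v.

(** The new chords are [{p_x, p_y*}] and [{p_x*, p_y}]. *)
Definition cross_word (x y : nat) (u v : seq nat) : seq nat :=
  u ++ swap_letters x y v.

(** The circle may always be cut just before an endpoint of the chord [a] to
    which the recurrence is applied. *)
Definition is_sl2_weight_system (w : {linear diagram_space -> {poly C}}) : Prop :=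
  [/\ is_weight_system w,
      w (word_vec [::]) = 1
    & forall (a : nat) (u v : seq nat),
        double_occurrence (a :: u ++ a :: v) ->
        let cr := crossing_chords a u v in
        let k := size cr in
        w (word_vec (a :: u ++ a :: v)) =
          ('X - (k%:R / 2)%:P) * w (word_vec (u ++ v))
          + (2^-1 : C) *:
            \sum_(i < k) \sum_(j < k | (i < j)%N)
              (w (word_vec (parallel_word (nth 0%N cr i) (nth 0%N cr j) u v))
               - w (word_vec (cross_word (nth 0%N cr i) (nth 0%N cr j) u v)))].

Definition extends (M : lmodType C) (g : {linear graph_space -> M})
    (w : diagram_space -> M) : Prop :=
  forall D : chord_word, g (intersection_vec D) = w (diagram_vec D).

Definition determined_by_intersection_graph (M : lmodType C)
    (w : {linear diagram_space -> M}) : Prop :=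
  forall D E : chord_word,
    isomorphic (intersection_graph D) (intersection_graph E) ->
    w (diagram_vec D) = w (diagram_vec E).

End Invariants.

Lemma double_occurrenceP s :
  reflect (forall x, count_mem x s = 0%N \/ count_mem x s = 2%N)
          (double_occurrence s).
Proof.
apply: (iffP idP) => [ds x|H].
  by rewrite (double_occurrence_count _ ds); case: ifP => _; [right | left].
apply/allP => x xs; have [/count_memPn|-> //] := H x.
by rewrite xs.
Qed.

Lemma double_occurrence_perm s t :
  perm_eq s t -> double_occurrence s = double_occurrence t.
Proof.
by move=> st; apply/double_occurrenceP/double_occurrenceP => H x;
  have := H x; rewrite (permP st).
Qed.

Lemma double_occurrence_delete a u v :
  double_occurrence (a :: u ++ a :: v) -> double_occurrence (u ++ v).
Proof.
move=> /double_occurrenceP H; apply/double_occurrenceP => x; have := H x.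
rewrite /= !count_cat /=.
case: (eqVneq a x) => _ /=; rewrite ?add0n ?add1n //.
by rewrite addnS => -[//|[] ->]; left.
Qed.

Lemma crossing_chordsP a u v b :
  double_occurrence (a :: u ++ a :: v) ->
  (b \in crossing_chords a u v) = (count_mem b u == 1%N) && (count_mem b v == 1%N).
Proof.
move=> /double_occurrenceP H.
have filt s : count_mem a s = 0%N ->
    [seq z <- s | (z == a) || (z == b)] = nseq (count_mem b s) b.
  elim: s => //= z s IH; case: (eqVneq z a) => //= _ /IH ->.
  by case: (eqVneq z b) => [->|].
have [ua va] : count_mem a u = 0%N /\ count_mem a v = 0%N.
  have := H a; rewrite /= !count_cat /= eqxx; lia.
rewrite mem_filter mem_undup mem_cat -!has_pred1 !has_count /interlaced.
have [<-|ab] := eqVneq a b; first by rewrite ua.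
rewrite /= eqxx filter_cat /= eqxx !filt //.
have := H b; rewrite /= count_cat /= (negbTE ab) /= !add0n.
have ba : (b == a) = false by rewrite eq_sym (negbTE ab).
case: (count_mem b u) => [|[|[|m]]]; case: (count_mem b v) => [|[|[|n]]] //=;
  by rewrite ?eqseq_cons ?eqxx ?ba ?(negbTE ab) ?andbF //=; lia.
Qed.

Lemma double_occurrence_parallel a u v x y :
  double_occurrence (a :: u ++ a :: v) -> x != y ->
  x \in crossing_chords a u v -> y \in crossing_chords a u v ->
  double_occurrence (parallel_word x y u v).
Proof.
move=> ds xy; rewrite !crossing_chordsP // => /andP[/eqP xu /eqP xv].
move=> /andP[/eqP yu /eqP yv].
have /double_occurrenceP H := double_occurrence_delete ds.
have count_rename p q s z : p != q -> count_mem z (rename p q s) =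
    if z == p then 0%N
    else if z == q then (count_mem p s + count_mem q s)%N else count_mem z s.
  move=> pq; elim: s => [|c s IH] /=; first by rewrite !if_same.
  rewrite IH; case: (eqVneq z p) => [->|zp].
    by case: (eqVneq c p) => [_|/negbTE ->]; rewrite // eq_sym (negbTE pq).
  case: (eqVneq z q) => [->|zq].
    case: (eqVneq c p) => [->|_] /=; first by rewrite eqxx; lia.
    by rewrite addnCA.
  case: (eqVneq c p) => [->|_ //].
  by rewrite eq_sym (negbTE zq) eq_sym (negbTE zp).
apply/double_occurrenceP => z; have := H z.
have yx : y != x by rewrite eq_sym.
rewrite !count_cat (count_rename y x) // (count_rename x y) //.
case: (eqVneq z x) => [->|_]; first by rewrite (negbTE xy) xu yu; right.
by case: (eqVneq z y) => [_|_ //]; rewrite xv yv; right.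
Qed.

Lemma double_occurrence_cross a u v x y :
  double_occurrence (a :: u ++ a :: v) -> x != y ->
  x \in crossing_chords a u v -> y \in crossing_chords a u v ->
  double_occurrence (cross_word x y u v).
Proof.
move=> ds xy; rewrite !crossing_chordsP // => /andP[/eqP xu /eqP xv].
move=> /andP[/eqP yu /eqP yv].
have /double_occurrenceP H := double_occurrence_delete ds.
have count_swap s z : count_mem z (swap_letters x y s) =
    count_mem (if z == x then y else if z == y then x else z) s.
  elim: s => //= c s ->; congr (nat_of_bool _ + _)%N.
  apply/eqP/eqP; case: (eqVneq c x) => [->|/eqP cx]; case: (eqVneq z x) => [->|/eqP zx];
    try case: (eqVneq c y) => [->|/eqP cy]; try case: (eqVneq z y) => [->|/eqP zy];
    congruence.
apply/double_occurrenceP => z; have := H z.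
rewrite !count_cat count_swap.
case: (eqVneq z x) => [->|_]; first by rewrite xu xv yv.
by case: (eqVneq z y) => [->|_ //]; rewrite yu xv yv.
Qed.

Lemma double_occurrence_fourT a b u v :
  double_occurrence (a :: u ++ a :: b :: v) ->
  [/\ double_occurrence (a :: u ++ b :: a :: v),
      double_occurrence (a :: b :: u ++ a :: v)
    & double_occurrence (b :: a :: u ++ a :: v)].
Proof.
move=> ds; split; rewrite -(double_occurrence_perm _ (s := a :: u ++ a :: b :: v)) //;
  by apply/permP => P; rewrite /= !count_cat /=; lia.
Qed.

(* Main.v *)
(** The 4-term relations of graphs with 9 vertices are inconsistent with the values
    of the sl(2)-weight system on circle graphs: starting from 102 chord diagrams of
    order 9, a chain of 4-term relations determines the values of an extension on 58
    graphs which are not circle graphs, and one further relation computes one of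
    these values a second time. The two results differ by a multiple of
    [c (8c - 3) (c - 1) (32c + 3)]. *)
Require Import Defs.
From Stdlib Require Import ZArith.
From HB Require Import structures.
From mathcomp Require Import all_boot all_order all_algebra.
From mathcomp Require Import generic_quotient boolp reals.
From mathcomp Require Import complex freeg.
From mathcomp Require Import ring ssrZ zify.

Set Implicit Arguments.
Unset Strict Implicit.
Unset Printing Implicit Defensive.

Import Order.TTheory GRing.Theory Num.Theory.
Local Open Scope ring_scope.
Local Open Scope quotient_scope.
Local Open Scope complex_scope.

(** Both parts reduce to one vanishing statement at a fixed value [t] of the Casimir variable. The
    4-term relation only has coefficients 1 and -1, so evaluating a polynomial-valued extension at
    [t] gives a scalar 4-invariant, and (1) needs just one [t] that is not a root of the
    obstruction. The obstacle is the size of the verification, which shapes all encodings. Graphs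
    become boolean relations on natural numbers, so that flips and slides can be evaluated; values
    become lists of binary integers, after rescaling by a power of 2 and passing to the variable 2c;
    the recurrence is run with a memo. The chain of relations is untrusted data: every isomorphism
    comes with its permutation and every halving is tested, so that nothing has to be searched
    for. *)

Section IntegerPolynomials.

(** * Integer polynomials, constant coefficient first, trailing zeros allowed *)

Fixpoint zpoly_add (p q : seq Z) : seq Z :=
  match p, q with
  | a :: p', b :: q' => Z.add a b :: zpoly_add p' q'
  | [::], _ => q
  | _, [::] => p
  end.

Definition zpoly_scale (c : Z) (p : seq Z) : seq Z := map (Z.mul c) p.

Definition zpoly_sub (p q : seq Z) : seq Z := zpoly_add p (zpoly_scale (Zneg xH) q).

Variables (K : comNzRingType) (x : K).

Definition zpoly_eval (p : seq Z) : K :=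
  foldr (fun a y => (int_of_Z a)%:~R + x * y) 0 p.

Lemma zpoly_evalD p q : zpoly_eval (zpoly_add p q) = zpoly_eval p + zpoly_eval q.
Proof.
elim: p q => [|a p IH] [|b q] /=; rewrite ?addr0 ?add0r // IH.
by rewrite (rmorphD int_of_Z) intrD mulrDr addrACA.
Qed.

Lemma zpoly_evalZ c p :
  zpoly_eval (zpoly_scale c p) = (int_of_Z c)%:~R * zpoly_eval p.
Proof.
elim: p => [|a p IH] /=; first by rewrite mulr0.
by rewrite IH (rmorphM int_of_Z) intrM mulrDr mulrCA.
Qed.

Lemma zpoly_evalB p q : zpoly_eval (zpoly_sub p q) = zpoly_eval p - zpoly_eval q.
Proof. by rewrite zpoly_evalD zpoly_evalZ mulN1r. Qed.

End IntegerPolynomials.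

(** * Tries indexed by words *)

Section WordTries.
Variable A : Type.

(** A letter is the position of a child, and a missing child reads as [trie0] through the default of
    [nth]. The lists of children stay short because words are relabelled by letters below their
    number of chords. *)
Inductive trie := Trie of option A & seq trie.

Definition trie0 : trie := Trie None [::].

Fixpoint trie_find (s : seq nat) (T : trie) : option A :=
  let: Trie o ch := T in
  if s is i :: s' then trie_find s' (nth trie0 ch i) else o.

Fixpoint trie_insert (s : seq nat) (y : A) (T : trie) : trie :=
  let: Trie o ch := T in
  if s is i :: s' then Trie o (set_nth trie0 ch i (trie_insert s' y (nth trie0 ch i)))
  else Trie (Some y) ch.

Lemma trie_find0 s : trie_find s trie0 = None.
Proof. by elim: s => //= i s; rewrite nth_nil. Qed.

Lemma trie_find_insert s s' y T :
  trie_find s (trie_insert s' y T) = if s == s' then Some y else trie_find s T.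
Proof.
elim: s' s T => [|i s' IH] [|j s] [o ch] //=.
by rewrite nth_set_nth /= eqseq_cons; case: eqVneq => //= ->.
Qed.

End WordTries.

(** * The double sum of the recurrence as a sum over a list of pairs *)

Section OrderedPairs.

Fixpoint ordered_pairs (s : seq nat) : seq (nat * nat) :=
  if s is x :: r then [seq (x, y) | y <- r] ++ ordered_pairs r else [::].

Lemma ordered_pairsP s x y :
  uniq s -> (x, y) \in ordered_pairs s -> [/\ x \in s, y \in s & x != y].
Proof.
elim: s => //= z s IH /andP[zs us]; rewrite mem_cat => /orP[/mapP[y' y's [-> ->]]|].
  by rewrite !inE eqxx y's orbT; split=> //; apply: contraNneq zs => ->.
by case/(IH us) => xs ys xy; rewrite !inE xs ys !orbT.
Qed.

Lemma sum_ordered_pairs (V : nmodType) (F : nat -> nat -> V) (s : seq nat) :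
  \sum_(i < size s) \sum_(j < size s | (i < j)%N) F (nth 0%N s i) (nth 0%N s j)
  = \sum_(p <- ordered_pairs s) F p.1 p.2.
Proof.
elim: s => [|x s IH] /=; first by rewrite big_ord0 big_nil.
rewrite big_ord_recl big_cat /= -IH big_map; congr (_ + _).
  rewrite big_mkcond big_ord_recl /= add0r (big_nth 0%N) big_mkord.
  exact: eq_bigr.
apply: eq_bigr => i _; rewrite [LHS]big_mkcond big_ord_recl /= add0r.
by rewrite [RHS]big_mkcond; apply: eq_bigr.
Qed.

End OrderedPairs.

(** * Computing sl(2) values with a memo *)

Definition relabel (s : seq nat) : seq nat := map (index^~ (undup s)) s.

Definition crossing_number (s : seq nat) : nat :=
  if s is a :: t then let u := take (index a t) t in
    count (fun b => count_mem b u == 1%N) u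
  else 0.

(** A chord with few crossings keeps the recurrence small; its correctness does not
    depend on the choice. *)
Definition pivot (s : seq nat) : nat :=
  let f := [seq crossing_number (rot i s) | i <- iota 0 (size s)] in
  index (foldr minn (size s) f) f.

(** For a diagram of order [n] the polynomial [2 ^ n * w] has integer coefficients
    in the variable [2 c]; these are computed here, [T] recording the words already
    treated. *)
Fixpoint sl2_poly (n : nat) (s : seq nat) (T : trie (seq Z)) :
    trie (seq Z) * seq Z :=
  if trie_find s T is Some P then (T, P) else
  if n is m.+1 then
    if rot (pivot s) s is a :: t then
      let u := take (index a t) t in
      let v := drop (index a t).+1 t in
      let cr := crossing_chords a u v in
      let: (T0, P0) := sl2_poly m (relabel (u ++ v)) T in
      let: (T1, Q) := foldl (fun st p =>
        let: (T, Q) := st in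
        let: (T', P') := sl2_poly m (relabel (parallel_word p.1 p.2 u v)) T in
        let: (T'', P'') := sl2_poly m (relabel (cross_word p.1 p.2 u v)) T' in
        (T'', zpoly_add Q (zpoly_sub P' P''))) (T0, [::]) (ordered_pairs cr) in
      let P := zpoly_add (zpoly_sub (Z0 :: P0) (zpoly_scale (Z.of_nat (size cr)) P0)) Q in
      (trie_insert s P T1, P)
    else (T, [::])
  else (T, [:: Zpos xH]).

Lemma size_parallel_word x y u v : size (parallel_word x y u v) = size (u ++ v).
Proof. by rewrite !size_cat !size_map. Qed.

Lemma size_cross_word x y u v : size (cross_word x y u v) = size (u ++ v).
Proof. by rewrite !size_cat !size_map. Qed.

Lemma word_vec_rot (R : realType) k (s : seq nat) : double_occurrence s ->
  word_vec R (rot k s) = word_vec R s.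
Proof.
move=> ds; have ds' : double_occurrence (rot k s).
  by rewrite (double_occurrence_perm (t := s)) // perm_rot.
rewrite /word_vec (insubT _ ds) (insubT _ ds') /= /diagram_vec.
suff -> : \pi_chord_diagram (ChordWord ds') = \pi_chord_diagram (ChordWord ds) by [].
apply/esym/eqmodP; apply/asboolP; exists k, id; split=> //.
by rewrite map_id.
Qed.

Lemma relabel_double_occurrence s :
  double_occurrence s -> double_occurrence (relabel s).
Proof.
move=> /allP ds; apply/allP => _ /mapP[y ys ->].
rewrite count_map -(eqP (ds _ ys)); apply/eqP/eq_in_count => z zs /=.
apply/eqP/eqP => [|-> //] /(congr1 (nth 0%N (undup s))).
by rewrite !nth_index ?mem_undup.
Qed.

(** This justifies relabelling before each recursive call, which lets words that differ only in the
    names of their chords share memo entries. *)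
Lemma word_vec_relabel (R : realType) (s : seq nat) : double_occurrence s ->
  word_vec R (relabel s) = word_vec R s.
Proof.
move=> ds; have ds' := relabel_double_occurrence ds.
rewrite /word_vec (insubT _ ds) (insubT _ ds') /= /diagram_vec.
suff -> : \pi_chord_diagram (ChordWord ds') = \pi_chord_diagram (ChordWord ds) by [].
apply/esym/eqmodP; apply/asboolP; exists 0%N, (index^~ (undup s)); split=> /=.
  move=> x y xs ys /(congr1 (nth 0%N (undup s))).
  by rewrite !nth_index ?mem_undup.
by rewrite rot0.
Qed.

(** * Correctness of the computed values *)

Section Sl2Values.
Variable R : realType.
Variables (w : {linear diagram_space R -> {poly R[i]}}) (t : R[i]).
Hypothesis hw : is_sl2_weight_system w.

Definition sl2_value (s : seq nat) : R[i] := (w (word_vec R s)).[t].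

Definition represents (P : seq Z) (n : nat) (y : R[i]) : Prop :=
  zpoly_eval (2 * t) P = 2 ^+ n * y.

(** Multiplying the recurrence by [2 ^+ n.+1] absorbs both halves: [t - k / 2] becomes [2 * t - k],
    and the factor 1/2 of the sum disappears. This is why integers suffice. *)
Lemma sl2_value_rec n a u v : size (u ++ v) = n.*2 ->
  double_occurrence (a :: u ++ a :: v) ->
  let cr := crossing_chords a u v in
  2 ^+ n.+1 * sl2_value (a :: u ++ a :: v) =
    (2 * t - (size cr)%:R) * (2 ^+ n * sl2_value (u ++ v))
    + \sum_(p <- ordered_pairs cr)
        (2 ^+ n * sl2_value (parallel_word p.1 p.2 u v)
         - 2 ^+ n * sl2_value (cross_word p.1 p.2 u v)).
Proof.
move=> szn ds cr; have [_ _ /(_ a u v ds)] := hw.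
rewrite -/cr /sl2_value /= => ->.
rewrite (sum_ordered_pairs (fun x y => w (word_vec R (parallel_word x y u v))
  - w (word_vec R (cross_word x y u v)))).
rewrite hornerD hornerM hornerXsubC hornerZ horner_sum.
under [X in _ = _ + X]eq_bigr => p _ do rewrite -mulrBr -hornerN -hornerD.
rewrite -mulr_sumr exprS.
have h2 : (2 : R[i]) != 0 by rewrite pnatr_eq0.
by field.
Qed.

(** The scaling exponent is read off the length of the key, so one memo serves diagrams of all
    orders. *)
Definition sound_memo (T : trie (seq Z)) : Prop :=
  forall s P, trie_find s T = Some P ->
    represents P (size s)./2 (sl2_value s).

Lemma sl2_value_relabel s : double_occurrence s ->
  sl2_value (relabel s) = sl2_value s.
Proof. by move=> ds; rewrite /sl2_value word_vec_relabel. Qed.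

(** The memo is threaded through the recursive calls, so its soundness has to be part of the
    induction together with the value. *)
Lemma sl2_polyP n s T : size s = n.*2 -> double_occurrence s -> sound_memo T ->
  sound_memo (sl2_poly n s T).1 /\ represents (sl2_poly n s T).2 n (sl2_value s).
Proof.
elim: n s T => [|m IH] s T szs ds sT /=.
  case E: (trie_find s T) => [P|] /=; first by split=> //; have := sT _ _ E; rewrite szs.
  split=> //; case: s szs {ds E} => // _; rewrite /represents /= mulr0 addr0.
  by rewrite /sl2_value; have [_ -> _] := hw; rewrite hornerC mulr1.
case E: (trie_find s T) => [P|] /=.
  by split=> //; have := sT _ _ E; rewrite szs doubleK.
have ds' : double_occurrence (rot (pivot s) s).
  by rewrite (double_occurrence_perm (t := s)) // perm_rot.
have szs' : size (rot (pivot s) s) = m.+1.*2 by rewrite size_rot.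
have val_s : sl2_value (rot (pivot s) s) = sl2_value s.
  by rewrite /sl2_value word_vec_rot.
case: (rot _ _) ds' szs' val_s => [//|a r] ds' szs' val_s.
set u := take _ r; set v := drop _ r.
have Er : r = u ++ a :: v.
  have ar : a \in r.
    have := allP ds' a (mem_head _ _); rewrite /= eqxx add1n eqSS => /eqP c1.
    by rewrite -has_pred1 has_count c1.
  by rewrite -[LHS](cat_take_drop (index a r)) (drop_nth a) ?index_mem // nth_index.
move: ds' szs' val_s; rewrite Er => ds' szs' val_s.
have szuv : size (u ++ v) = m.*2.
  by move: szs'; rewrite /= !size_cat /= addnS doubleS => -[].
set cr := crossing_chords a u v.
have relabelP z T' : size z = m.*2 -> double_occurrence z -> sound_memo T' ->
    sound_memo (sl2_poly m (relabel z) T').1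
    /\ represents (sl2_poly m (relabel z) T').2 m (sl2_value z).
  move=> szz dz sT'; rewrite -(sl2_value_relabel dz); apply: IH => //.
    by rewrite size_map.
  exact: relabel_double_occurrence.
have [] := relabelP (u ++ v) T szuv (double_occurrence_delete ds') sT.
case: (sl2_poly _ _ _) => T0 P0 /= sT0 rP0.
set step := (X in foldl X).
(* The remaining pairs vary while [cr] stays fixed. Membership among the pairs of [cr] supplies two
   distinct crossing chords, hence double occurrence of the two new words. *)
have foldP l T' Q y : {subset l <= ordered_pairs cr} -> sound_memo T' ->
    zpoly_eval (2 * t) Q = y ->
    sound_memo (foldl step (T', Q) l).1 /\
    zpoly_eval (2 * t) (foldl step (T', Q) l).2 = y + \sum_(p <- l)
        (2 ^+ m * sl2_value (parallel_word p.1 p.2 u v)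
         - 2 ^+ m * sl2_value (cross_word p.1 p.2 u v)).
  elim: l T' Q y => [|[x z] l IHl] T' Q y sub sT' eQ /=.
    by rewrite big_nil addr0.
  have [xcr zcr xz] : [/\ x \in cr, z \in cr & x != z].
    apply: ordered_pairsP; last by apply: sub; rewrite mem_head.
    by rewrite filter_uniq // undup_uniq.
  have := relabelP (parallel_word x z u v) T'.
  rewrite size_parallel_word => /(_ szuv (double_occurrence_parallel ds' xz xcr zcr) sT').
  case: (sl2_poly _ _ _) => T1 P1 /= [sT1 rP1].
  have := relabelP (cross_word x z u v) T1.
  rewrite size_cross_word => /(_ szuv (double_occurrence_cross ds' xz xcr zcr) sT1).
  case: (sl2_poly _ _ _) => T2 P2 /= [sT2 rP2].
  rewrite big_cons addrA; apply: IHl => //.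
    by move=> q ql; apply: sub; rewrite inE ql orbT.
  by rewrite zpoly_evalD zpoly_evalB eQ rP1 rP2.
have [] := foldP (ordered_pairs cr) T0 [::] 0 (fun _ => id) sT0 erefl.
case: (foldl _ _ _) => T1 Q /= sT1 eQ.
suff rP : represents (zpoly_add (zpoly_sub (Z0 :: P0)
    (zpoly_scale (Z.of_nat (size cr)) P0)) Q) m.+1 (sl2_value s).
  split=> // s' P; rewrite trie_find_insert; case: eqP => [-> [<-]|_]; last exact: sT1.
  by rewrite szs doubleK.
rewrite /represents -val_s sl2_value_rec // zpoly_evalD zpoly_evalB zpoly_evalZ.
rewrite eQ add0r /= rP0 -/cr; congr (_ + _).
have -> : int_of_Z (Z.of_nat (size cr)) = (size cr)%:Z by lia.
rewrite mulrBl add0r; congr (_ * _ - _ * _); exact: pmulrn.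
Qed.

End Sl2Values.

(** * Graphs as relations on natural numbers *)

Section NatGraphs.

(** Symmetrising and removing loops makes every relation a graph, without proofs inside the data; a
    symmetric irreflexive [e] is unchanged. *)
Definition nat_graph_rel n (e : rel nat) : rel 'I_n :=
  fun i j => (i != j) && (e i j || e j i).

Lemma nat_graph_rel_sym n e : symmetric (@nat_graph_rel n e).
Proof. by move=> i j; rewrite /nat_graph_rel eq_sym orbC. Qed.

Lemma nat_graph_rel_irr n e : irreflexive (@nat_graph_rel n e).
Proof. by move=> i; rewrite /nat_graph_rel eqxx. Qed.

Definition nat_graph n (e : rel nat) : graph_on n :=
  graph_of_rel (@nat_graph_rel_sym n e) (@nat_graph_rel_irr n e).

Lemma adj_nat_graph n e (i j : 'I_n) : symmetric e -> irreflexive e ->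
  adj (nat_graph n e) i j = e i j.
Proof.
move=> es ei; rewrite adj_graph_of_rel /nat_graph_rel [e j i]es orbb.
by case: eqVneq => [->|//]; rewrite ei.
Qed.

Lemma graph_on_eq n (G H : graph_on n) : adj G =2 adj H -> G = H.
Proof. by move=> GH; apply/val_inj/matrixP => i j; exact: GH. Qed.

Definition edge_flip (a b : nat) (e : rel nat) : rel nat := fun x y =>
  e x y (+) (((x == a) && (y == b)) || ((x == b) && (y == a))).

Definition edge_slide (a b : nat) (e : rel nat) : rel nat := fun x y =>
  let sw v := [&& v != a, v != b & e v b] in
  e x y (+) (((x == a) && sw y) || ((y == a) && sw x)).

Variables (a b : nat) (e : rel nat).
Hypotheses (es : symmetric e) (ei : irreflexive e) (ab : a != b).

Lemma edge_flip_sym : symmetric (edge_flip a b e).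
Proof. by move=> x y; rewrite /edge_flip es orbC ![(_ == a) && _]andbC. Qed.

Lemma edge_flip_irr : irreflexive (edge_flip a b e).
Proof.
move=> x; rewrite /edge_flip ei /=.
by case: (eqVneq x a) => [->|] /=; rewrite ?(negbTE ab) ?andbF.
Qed.

Lemma edge_slide_sym : symmetric (edge_slide a b e).
Proof. by move=> x y; rewrite /edge_slide es orbC. Qed.

Lemma edge_slide_irr : irreflexive (edge_slide a b e).
Proof. by move=> x; rewrite /edge_slide ei orbb; case: (x == a). Qed.

Lemma edge_flipK : edge_flip a b (edge_flip a b e) =2 e.
Proof. by move=> x y; rewrite /edge_flip addbK. Qed.

(** The vertices switched by the slide exclude [a] and [b], so the state of the edge [ab] does not
    affect which they are. *)
Lemma edge_slide_flip :
  edge_slide a b (edge_flip a b e) =2 edge_flip a b (edge_slide a b e).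
Proof.
move=> x y; rewrite /edge_slide /edge_flip.
by case: (eqVneq x a) => [->|xa]; case: (eqVneq y a) => [->|ya];
  rewrite ?eqxx ?(negbTE ab) ?(negbTE xa) ?(negbTE ya) /= ?andbF ?andbT ?orbF ?addbF //=;
  try case: (eqVneq y b) => [->|yb]; try case: (eqVneq x b) => [->|xb];
  rewrite ?andbF ?andbT ?orbF ?addbF ?addFb //=.
Qed.

End NatGraphs.

(** The isomorphism is given as its list of images, so testing it is a plain evaluation over pairs
    of vertices. *)
Definition relabelling (n : nat) (e1 e2 : rel nat) (p : seq nat) : bool :=
  perm_eq p (iota 0 n) &&
  all (fun i => all (fun j => e1 i j == e2 (nth 0%N p i) (nth 0%N p j)) (iota 0 n))
    (iota 0 n).

Lemma relabelling_isomorphic n e1 e2 p :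
  symmetric e1 -> irreflexive e1 -> symmetric e2 -> irreflexive e2 ->
  relabelling n e1 e2 p ->
  isomorphic (fgraph_of (nat_graph n e1)) (fgraph_of (nat_graph n e2)).
Proof.
move=> s1 i1 s2 i2 /andP[pp /allP eqp].
have szp : size p = n by rewrite (perm_size pp) size_iota.
have pn (i : 'I_n) : (nth 0%N p i < n)%N.
  have : nth 0%N p i \in p by rewrite mem_nth ?szp.
  by rewrite (perm_mem pp) mem_iota.
apply/asboolP; exists (fun i => Ordinal (pn i)); split.
  apply: injF_bij => i j /(congr1 val) /= /eqP.
  rewrite nth_uniq ?szp //; first by move/eqP/val_inj.
  by rewrite (perm_uniq pp) iota_uniq.
move=> i j; rewrite !adj_nat_graph //=.
have := eqp i; rewrite mem_iota /= => /(_ (ltn_ord i)) /allP/(_ j).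
by rewrite mem_iota /= => /(_ (ltn_ord j)) /eqP.
Qed.

(** One graph numbers the chords by their position in [undup D], the other by the letters
    themselves; reading the letter at a position is the isomorphism. *)
Lemma intersection_graph_nat n (D : chord_word) :
  perm_eq (undup D) (iota 0 n) ->
  isomorphic (intersection_graph D) (fgraph_of (nat_graph n (interlaced D))).
Proof.
move=> pD; have szD : size (undup D) = n by rewrite (perm_size pD) size_iota.
have Dn (i : 'I_(size (undup D))) : (nth 0%N (undup D) i < n)%N.
  have : nth 0%N (undup D) i \in undup D by rewrite mem_nth.
  by rewrite (perm_mem pD) mem_iota.
apply/asboolP; exists (fun i => Ordinal (Dn i)); split.
  apply: inj_card_bij => [i j /(congr1 val) /= /eqP|]; last by rewrite !card_ord /= szD.
  by rewrite nth_uniq ?undup_uniq // => /eqP/val_inj.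
move=> i j; rewrite adj_nat_graph; last 2 first.
- exact: interlaced_sym.
- exact: interlaced_irr.
by rewrite adj_graph_of_rel.
Qed.

(** * The 4-term relation for isomorphism-invariant functions of graphs *)

Section FourInvariants.
Variables (K : fieldType) (gamma : Defs.fgraph -> K).
Hypothesis gamma_iso : forall G H, isomorphic G H -> gamma G = gamma H.
Hypothesis gamma_4T : forall n (G : graph_on n) (a b : 'I_n), adj G a b ->
  gamma (fgraph_of G) - gamma (fgraph_of (del_edge G a b))
  = gamma (fgraph_of (slide G a b))
    - gamma (fgraph_of (del_edge (slide G a b) a b)).

Variable n : nat.

Definition rel_value (e : rel nat) : K := gamma (fgraph_of (nat_graph n e)).

Lemma eq_rel_value e1 e2 : e1 =2 e2 -> rel_value e1 = rel_value e2.
Proof.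
move=> e12; congr (gamma (fgraph_of _)); apply: graph_on_eq => i j.
by rewrite !adj_graph_of_rel /nat_graph_rel !e12.
Qed.

Lemma rel_value_relabelling e1 e2 p :
  symmetric e1 -> irreflexive e1 -> symmetric e2 -> irreflexive e2 ->
  relabelling n e1 e2 p -> rel_value e1 = rel_value e2.
Proof. by move=> *; apply/gamma_iso/relabelling_isomorphic; eassumption. Qed.

(** The 4-term relation does not depend on which of the two diagrams carries the
    edge [ab]: exchanging [e] and its flip only changes the sign. *)
Lemma rel_value_flip a b e : symmetric e -> irreflexive e ->
    (a < n)%N -> (b < n)%N -> a != b ->
  rel_value (edge_flip a b e)
  = rel_value e + rel_value (edge_slide a b (edge_flip a b e))
    - rel_value (edge_slide a b e).
Proof.
move=> es ei an bn ab.
have edge f : symmetric f -> irreflexive f -> f a b ->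
    rel_value f - rel_value (edge_flip a b f)
    = rel_value (edge_slide a b f) - rel_value (edge_slide a b (edge_flip a b f)).
  move=> fs fi fab.
  pose i := Ordinal an; pose j := Ordinal bn.
  have slideE : slide (nat_graph n f) i j = nat_graph n (edge_slide a b f).
    apply: graph_on_eq => x y; rewrite !adj_graph_of_rel /slide_rel /switched.
    rewrite !adj_nat_graph // /nat_graph_rel -/(adj _ x y).
    have := adj_nat_graph x y (edge_slide_sym a b fs) (edge_slide_irr a b fi).
    by rewrite adj_graph_of_rel /nat_graph_rel => ->.
  have delE f' : symmetric f' -> irreflexive f' -> f' a b ->
      del_edge (nat_graph n f') i j = nat_graph n (edge_flip a b f').
    move=> fs' fi' fab'; apply: graph_on_eq => x y.
    rewrite !adj_graph_of_rel /del_edge_rel adj_nat_graph //.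
    have := adj_nat_graph x y (edge_flip_sym a b fs') (edge_flip_irr fi' ab).
    rewrite adj_graph_of_rel => ->; rewrite /edge_flip -!val_eqE /=.
    (* Deletion is a flip only because the edge is present: [X] implies adjacency. *)
    set X := (_ && _) || _; have : X -> f' x y.
      by case/orP => /andP[/eqP-> /eqP->] //; rewrite fs'.
    by case: X => [->|_] //; rewrite andbT addbF.
  have := @gamma_4T n (nat_graph n f) i j; rewrite adj_nat_graph // => /(_ fab).
  rewrite slideE !delE //.
  - rewrite -!/(rel_value _) => ->; congr (_ - _); apply: eq_rel_value => x y.
    by rewrite edge_slide_flip.
  - exact: edge_slide_sym.
  - exact: edge_slide_irr.
  by rewrite /edge_slide !eqxx [b == a]eq_sym (negbTE ab) /= addbF.
case fab: (e a b).
  rewrite -addrA -(opprB (rel_value (edge_slide a b e))) -(edge e es ei fab).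
  by ring.
have := edge (edge_flip a b e) (edge_flip_sym a b es) (edge_flip_irr ei ab).
rewrite {1}/edge_flip !eqxx fab /= => /(_ isT).
have K1 : rel_value (edge_flip a b (edge_flip a b e)) = rel_value e.
  by apply: eq_rel_value => x y; rewrite edge_flipK.
have K2 : rel_value (edge_slide a b (edge_flip a b (edge_flip a b e)))
    = rel_value (edge_slide a b e).
  by apply: eq_rel_value => x y; rewrite /edge_slide !edge_flipK.
by rewrite K1 K2 => /eqP; rewrite subr_eq => /eqP ->; ring.
Qed.

End FourInvariants.

(** * Chains of 4-term relations and their soundness *)

Section Certificates.

Definition entry := (rel nat * seq Z)%type.

Definition entry0 : entry := (fun _ _ => false, [::]).

Fixpoint diagram_table (n : nat) (c : Z) (ds : seq (seq nat)) (T : trie (seq Z)) :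
    seq entry :=
  if ds is D :: ds' then
    let: (T', P) := sl2_poly n D T in
    (interlaced D, zpoly_scale c P) :: diagram_table n c ds' T'
  else [::].

Definition diagram_on (n : nat) (D : seq nat) : bool :=
  [&& size D == n.*2, double_occurrence D & perm_eq (undup D) (iota 0 n)].

(** [Z.div2] rounds; doubling back tests that every coefficient is even. *)
Definition zpoly_half (p : seq Z) : option (seq Z) :=
  let q := map Z.div2 p in if zpoly_scale (Zpos 2) q == p then Some q else None.

(** A step [(i, a, b, (j, p), (k, q))] adds to a table the graph [U] obtained by
    changing the adjacency of [a] and [b] in its [i]-th graph. The 4-term relation
    expresses the value of [U] through that graph and its two slides, which have
    to be isomorphic to the graphs number [j] and [k]. An index [k] beyond the end
    of the table stands for [U] itself, so that the relation gives twice its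
    value. *)
Definition step := (nat * nat * nat * (nat * seq nat) * (nat * seq nat))%type.

Definition run_step (n : nat) (T : seq entry) (st : step) : option entry :=
  let: (i, a, b, (j, p), (k, q)) := st in
  let: (e, P) := nth entry0 T i in
  let: (f, Q) := nth entry0 T j in
  let U := edge_flip a b e in
  if [&& (i < size T)%N, (j < size T)%N, (a < n)%N, (b < n)%N, a != b
       & relabelling n (edge_slide a b U) f p] then
    if (k < size T)%N then
      let: (h, W) := nth entry0 T k in
      if relabelling n (edge_slide a b e) h q
      then Some (U, zpoly_sub (zpoly_add P Q) W) else None
    else if relabelling n (edge_slide a b e) U q
    then omap (pair U) (zpoly_half (zpoly_add P Q)) else None
  else None.

Fixpoint run_steps (n : nat) (T : seq entry) (sts : seq step) : option (seq entry) :=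
  if sts is st :: sts' then
    if run_step n T st is Some x then run_steps n (rcons T x) sts' else None
  else Some T.

Definition table_difference (n : nat) (T : seq entry) (m : nat) (p : seq nat) :
    option (seq Z) :=
  let: (e, P) := last entry0 T in
  let: (f, Q) := nth entry0 T m in
  if [&& (0 < size T)%N, (m < size T)%N & relabelling n e f p]
  then Some (zpoly_sub P Q) else None.

Variable R : realType.
Variables (w : {linear diagram_space R -> {poly R[i]}}) (t : R[i]).
Hypothesis hw : is_sl2_weight_system w.
Variable gamma : Defs.fgraph -> R[i].
Hypothesis gamma_iso : forall G H, isomorphic G H -> gamma G = gamma H.
Hypothesis gamma_4T : forall n (G : graph_on n) (a b : 'I_n), adj G a b ->
  gamma (fgraph_of G) - gamma (fgraph_of (del_edge G a b))
  = gamma (fgraph_of (slide G a b))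
    - gamma (fgraph_of (del_edge (slide G a b) a b)).
Hypothesis gamma_ext : forall D : chord_word,
  gamma (intersection_graph D) = (w (diagram_vec R D)).[t].

Variables (n : nat) (c : Z).

(** The power of 2 is the scaling of [sl2_poly]. Here [c] is an integer that leaves room for
    halvings, not the Casimir element. *)
Let scale : R[i] := (int_of_Z c)%:~R * 2 ^+ n.

Definition sound_entry (x : entry) : Prop :=
  [/\ symmetric x.1, irreflexive x.1
    & zpoly_eval (2 * t) x.2 = scale * rel_value gamma n x.1].

Definition sound_table (T : seq entry) : Prop :=
  forall i, (i < size T)%N -> sound_entry (nth entry0 T i).

Lemma rel_value_diagram D : diagram_on n D ->
  rel_value gamma n (interlaced D) = sl2_value w t D.
Proof.
case/and3P=> _ dD pD; pose E := ChordWord dD.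
rewrite /sl2_value /word_vec (insubT _ dD) /= -/E -gamma_ext.
exact/esym/gamma_iso/intersection_graph_nat.
Qed.

Lemma diagram_table_sound ds T : all (diagram_on n) ds -> sound_memo w t T ->
  sound_table (diagram_table n c ds T).
Proof.
elim: ds T => [|D ds IH] T //= /andP[dD dds] sT.
have /and3P[/eqP szD ddD _] := dD.
have := sl2_polyP hw szD ddD sT; case: (sl2_poly _ _ _) => T' P /= [sT' rP].
move=> [_|i /(IH _ dds sT')//]; split.
- exact: interlaced_sym.
- exact: interlaced_irr.
by rewrite zpoly_evalZ rP -(rel_value_diagram dD) mulrA.
Qed.

Lemma zpoly_halfP p q : zpoly_half p = Some q ->
  2 * zpoly_eval (2 * t) q = zpoly_eval (2 * t) p.
Proof. by rewrite /zpoly_half; case: eqP => // E [<-]; rewrite -[in RHS]E zpoly_evalZ. Qed.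

Lemma run_step_sound T st x : sound_table T -> run_step n T st = Some x ->
  sound_entry x.
Proof.
case: st => [[[[i a] b] [j p]] [k q]] sT /=.
case Ei: (nth _ T i) => [e P]; case Ej: (nth _ T j) => [f Q].
case: ifP => // /and5P[iT jT an bn /andP[ab rf]].
have := sT _ iT; rewrite Ei => -[/= es ei eP].
have := sT _ jT; rewrite Ej => -[/= fs fi fQ].
have us := edge_flip_sym a b es; have ui := edge_flip_irr ei ab.
have := rel_value_relabelling gamma_iso (edge_slide_sym a b us)
  (edge_slide_irr a b ui) fs fi rf.
have := rel_value_flip gamma_4T es ei an bn ab => U4 fU.
have ss := edge_slide_sym a b es; have si := edge_slide_irr a b ei.
case: ifP => [kT|_].
  have := sT _ kT; case: (nth _ T k) => [h W] [/= hs hi hW].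
  case: ifP => // /(rel_value_relabelling gamma_iso ss si hs hi) rh [<-]; split=> //=.
  by rewrite U4 fU rh zpoly_evalB zpoly_evalD eP fQ hW; ring.
case: ifP => // /(rel_value_relabelling gamma_iso ss si us ui) rU.
case Eh: (zpoly_half _) => [W|//] [<-]; split=> //=.
have h2 : (2 : R[i]) != 0 by rewrite pnatr_eq0.
apply: (mulfI h2); rewrite (zpoly_halfP Eh) zpoly_evalD eP fQ -fU.
rewrite -mulrDr; set vU := rel_value _ _ (edge_flip a b e).
suff <- : vU + vU = rel_value gamma n e
    + rel_value gamma n (edge_slide a b (edge_flip a b e)) by ring.
by rewrite {1}/vU U4 rU subrK.
Qed.

Lemma run_steps_sound T sts T' : sound_table T -> run_steps n T sts = Some T' ->
  sound_table T'.
Proof.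
elim: sts T => [|st sts IH] T sT /=; first by case=> <-.
case Ex: (run_step _ _ _) => [x|//]; apply: IH => i; rewrite size_rcons nth_rcons ltnS.
case: ltngtP => // [iT _|_ _]; [exact: sT | exact: run_step_sound Ex].
Qed.

(** The two entries carry isomorphic graphs, so both polynomials evaluate at [2 * t] to the same
    multiple of one value. *)
Lemma table_difference_sound T m p P : sound_table T ->
  table_difference n T m p = Some P -> zpoly_eval (2 * t) P = 0.
Proof.
move=> sT; rewrite /table_difference.
case El: (last _ T) => [e Q]; case Em: (nth _ T m) => [f W].
case: ifP => // /and3P[Tn mT r] [<-].
have lT : ((size T).-1 < size T)%N by case: (T) Tn.
have := sT _ lT; rewrite nth_last El => -[/= es ei eQ].
have := sT _ mT; rewrite Em => -[/= fs fi fW].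
by rewrite zpoly_evalB eQ fW (rel_value_relabelling gamma_iso es ei fs fi r) subrr.
Qed.

End Certificates.

(** * The certificate: starting diagrams, chain and resulting polynomial *)

Definition base_diagrams : seq (seq nat) := [::
  [:: 0; 1; 0; 2; 3; 1; 4; 3; 5; 4; 6; 7; 2; 8; 7; 6; 5; 8];
  [:: 0; 1; 0; 2; 3; 1; 4; 5; 3; 6; 2; 7; 6; 8; 7; 5; 8; 4];
  [:: 0; 1; 0; 2; 3; 4; 1; 5; 4; 6; 5; 7; 2; 8; 7; 6; 3; 8];
  [:: 0; 1; 0; 2; 3; 4; 2; 5; 1; 6; 4; 7; 8; 5; 6; 8; 7; 3];
  [:: 0; 1; 2; 0; 3; 1; 4; 5; 2; 6; 3; 7; 6; 8; 7; 5; 8; 4];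
  [:: 0; 1; 2; 0; 3; 1; 4; 5; 3; 6; 2; 7; 6; 8; 4; 5; 8; 7];
  [:: 0; 1; 2; 0; 3; 1; 4; 5; 3; 6; 2; 7; 6; 8; 7; 5; 8; 4];
  [:: 0; 1; 2; 0; 3; 1; 4; 5; 6; 3; 5; 7; 8; 4; 6; 2; 8; 7];
  [:: 0; 1; 2; 0; 3; 2; 4; 1; 5; 3; 6; 7; 8; 4; 5; 8; 6; 7];
  [:: 0; 1; 2; 0; 3; 2; 4; 1; 5; 4; 6; 5; 7; 3; 8; 7; 6; 8];
  [:: 0; 1; 2; 0; 3; 2; 4; 3; 5; 1; 6; 7; 8; 5; 4; 8; 6; 7];
  [:: 0; 1; 2; 0; 3; 2; 4; 3; 5; 6; 1; 7; 8; 5; 4; 7; 8; 6];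
  [:: 0; 1; 2; 0; 3; 2; 4; 5; 1; 6; 5; 7; 6; 3; 8; 7; 4; 8];
  [:: 0; 1; 2; 0; 3; 2; 4; 5; 1; 6; 7; 8; 6; 5; 3; 8; 4; 7];
  [:: 0; 1; 2; 0; 3; 2; 4; 5; 3; 6; 1; 7; 6; 8; 5; 7; 4; 8];
  [:: 0; 1; 2; 0; 3; 2; 4; 5; 3; 6; 4; 1; 7; 8; 6; 5; 7; 8];
  [:: 0; 1; 2; 0; 3; 2; 4; 5; 3; 6; 7; 4; 1; 8; 7; 5; 6; 8];
  [:: 0; 1; 2; 0; 3; 2; 4; 5; 3; 6; 7; 4; 8; 1; 6; 5; 8; 7];
  [:: 0; 1; 2; 0; 3; 2; 4; 5; 3; 6; 7; 4; 8; 7; 1; 6; 5; 8];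
  [:: 0; 1; 2; 0; 3; 2; 4; 5; 3; 6; 7; 8; 5; 1; 4; 8; 6; 7];
  [:: 0; 1; 2; 0; 3; 2; 4; 5; 6; 3; 4; 7; 8; 6; 1; 5; 7; 8];
  [:: 0; 1; 2; 0; 3; 2; 4; 5; 6; 3; 7; 5; 8; 1; 7; 4; 6; 8];
  [:: 0; 1; 2; 0; 3; 2; 4; 5; 6; 3; 7; 5; 8; 1; 7; 6; 8; 4];
  [:: 0; 1; 2; 0; 3; 4; 1; 5; 2; 6; 5; 7; 4; 8; 3; 7; 6; 8];
  [:: 0; 1; 2; 0; 3; 4; 1; 5; 2; 6; 7; 5; 3; 8; 4; 7; 8; 6];
  [:: 0; 1; 2; 0; 3; 4; 1; 5; 3; 6; 7; 5; 8; 7; 2; 8; 6; 4];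
  [:: 0; 1; 2; 0; 3; 4; 1; 5; 4; 6; 7; 3; 2; 7; 8; 6; 5; 8];
  [:: 0; 1; 2; 0; 3; 4; 1; 5; 4; 6; 7; 3; 8; 6; 2; 8; 7; 5];
  [:: 0; 1; 2; 0; 3; 4; 1; 5; 4; 6; 7; 5; 3; 2; 8; 6; 7; 8];
  [:: 0; 1; 2; 0; 3; 4; 1; 5; 6; 2; 7; 8; 6; 5; 3; 7; 4; 8];
  [:: 0; 1; 2; 0; 3; 4; 1; 5; 6; 3; 2; 7; 8; 6; 4; 5; 7; 8];
  [:: 0; 1; 2; 0; 3; 4; 1; 5; 6; 4; 7; 2; 3; 8; 7; 5; 6; 8];
  [:: 0; 1; 2; 0; 3; 4; 1; 5; 6; 4; 7; 2; 3; 8; 7; 5; 8; 6];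
  [:: 0; 1; 2; 0; 3; 4; 1; 5; 6; 4; 7; 8; 6; 3; 2; 7; 5; 8];
  [:: 0; 1; 2; 0; 3; 4; 1; 5; 6; 7; 2; 8; 7; 3; 8; 4; 6; 5];
  [:: 0; 1; 2; 0; 3; 4; 1; 5; 6; 7; 4; 2; 7; 8; 6; 3; 8; 5];
  [:: 0; 1; 2; 0; 3; 4; 1; 5; 6; 7; 4; 2; 8; 5; 7; 3; 8; 6];
  [:: 0; 1; 2; 0; 3; 4; 1; 5; 6; 7; 4; 8; 6; 2; 3; 8; 5; 7];
  [:: 0; 1; 2; 0; 3; 4; 1; 5; 6; 7; 8; 5; 6; 3; 2; 8; 4; 7];
  [:: 0; 1; 2; 0; 3; 4; 2; 5; 1; 3; 6; 5; 7; 6; 8; 7; 4; 8];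
  [:: 0; 1; 2; 0; 3; 4; 2; 5; 1; 6; 3; 4; 7; 6; 8; 7; 5; 8];
  [:: 0; 1; 2; 0; 3; 4; 2; 5; 1; 6; 4; 7; 6; 8; 3; 5; 8; 7];
  [:: 0; 1; 2; 0; 3; 4; 2; 5; 1; 6; 5; 7; 6; 3; 8; 7; 4; 8];
  [:: 0; 1; 2; 0; 3; 4; 2; 5; 1; 6; 7; 4; 5; 8; 6; 3; 8; 7];
  [:: 0; 1; 2; 0; 3; 4; 2; 5; 1; 6; 7; 5; 4; 7; 8; 6; 3; 8];
  [:: 0; 1; 2; 0; 3; 4; 2; 5; 1; 6; 7; 5; 8; 7; 3; 4; 8; 6];
  [:: 0; 1; 2; 0; 3; 4; 2; 5; 3; 6; 4; 7; 8; 1; 5; 6; 8; 7];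
  [:: 0; 1; 2; 0; 3; 4; 2; 5; 3; 6; 7; 5; 8; 6; 4; 1; 8; 7];
  [:: 0; 1; 2; 0; 3; 4; 2; 5; 3; 6; 7; 8; 1; 4; 7; 6; 5; 8];
  [:: 0; 1; 2; 0; 3; 4; 2; 5; 4; 6; 5; 7; 8; 6; 1; 8; 3; 7];
  [:: 0; 1; 2; 0; 3; 4; 2; 5; 4; 6; 7; 8; 5; 1; 7; 3; 6; 8];
  [:: 0; 1; 2; 0; 3; 4; 2; 5; 6; 1; 4; 7; 3; 8; 5; 7; 6; 8];
  [:: 0; 1; 2; 0; 3; 4; 2; 5; 6; 1; 4; 7; 5; 8; 7; 3; 6; 8];
  [:: 0; 1; 2; 0; 3; 4; 2; 5; 6; 1; 4; 7; 6; 8; 7; 3; 8; 5];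
  [:: 0; 1; 2; 0; 3; 4; 2; 5; 6; 1; 7; 5; 8; 7; 3; 4; 8; 6];
  [:: 0; 1; 2; 0; 3; 4; 2; 5; 6; 3; 7; 4; 1; 8; 6; 7; 5; 8];
  [:: 0; 1; 2; 0; 3; 4; 2; 5; 6; 3; 7; 5; 8; 6; 1; 4; 7; 8];
  [:: 0; 1; 2; 0; 3; 4; 2; 5; 6; 4; 7; 1; 8; 5; 6; 7; 3; 8];
  [:: 0; 1; 2; 0; 3; 4; 2; 5; 6; 4; 7; 8; 5; 1; 6; 8; 3; 7];
  [:: 0; 1; 2; 0; 3; 4; 2; 5; 6; 7; 1; 5; 8; 7; 4; 6; 3; 8];
  [:: 0; 1; 2; 0; 3; 4; 2; 5; 6; 7; 3; 8; 5; 7; 1; 4; 6; 8];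
  [:: 0; 1; 2; 0; 3; 4; 5; 1; 2; 6; 5; 7; 4; 8; 6; 7; 3; 8];
  [:: 0; 1; 2; 0; 3; 4; 5; 1; 6; 2; 4; 5; 7; 3; 8; 7; 6; 8];
  [:: 0; 1; 2; 0; 3; 4; 5; 1; 6; 2; 5; 7; 4; 8; 7; 6; 8; 3];
  [:: 0; 1; 2; 0; 3; 4; 5; 1; 6; 2; 7; 6; 4; 8; 3; 7; 5; 8];
  [:: 0; 1; 2; 0; 3; 4; 5; 1; 6; 3; 2; 7; 8; 6; 4; 7; 5; 8];
  [:: 0; 1; 2; 0; 3; 4; 5; 1; 6; 5; 7; 2; 4; 7; 8; 6; 3; 8];
  [:: 0; 1; 2; 0; 3; 4; 5; 1; 6; 5; 7; 2; 8; 7; 6; 3; 8; 4];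
  [:: 0; 1; 2; 0; 3; 4; 5; 1; 6; 5; 7; 3; 2; 7; 8; 6; 4; 8];
  [:: 0; 1; 2; 0; 3; 4; 5; 1; 6; 7; 2; 3; 5; 7; 8; 6; 4; 8];
  [:: 0; 1; 2; 0; 3; 4; 5; 1; 6; 7; 2; 5; 6; 4; 8; 7; 3; 8];
  [:: 0; 1; 2; 0; 3; 4; 5; 1; 6; 7; 5; 2; 3; 7; 8; 6; 4; 8];
  [:: 0; 1; 2; 0; 3; 4; 5; 2; 6; 1; 4; 5; 7; 6; 8; 7; 3; 8];
  [:: 0; 1; 2; 0; 3; 4; 5; 2; 6; 1; 5; 4; 7; 6; 8; 7; 3; 8];
  [:: 0; 1; 2; 0; 3; 4; 5; 2; 6; 1; 5; 7; 6; 8; 7; 4; 8; 3];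
  [:: 0; 1; 2; 0; 3; 4; 5; 2; 6; 1; 7; 4; 5; 8; 7; 6; 3; 8];
  [:: 0; 1; 2; 0; 3; 4; 5; 2; 6; 3; 7; 4; 1; 8; 5; 7; 6; 8];
  [:: 0; 1; 2; 0; 3; 4; 5; 2; 6; 4; 7; 3; 8; 6; 1; 8; 5; 7];
  [:: 0; 1; 2; 0; 3; 4; 5; 2; 6; 4; 7; 6; 8; 7; 1; 3; 8; 5];
  [:: 0; 1; 2; 0; 3; 4; 5; 2; 6; 4; 7; 8; 1; 6; 7; 5; 3; 8];
  [:: 0; 1; 2; 0; 3; 4; 5; 2; 6; 5; 7; 6; 1; 3; 8; 7; 4; 8];
  [:: 0; 1; 2; 0; 3; 4; 5; 2; 6; 7; 1; 8; 6; 4; 5; 8; 3; 7];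
  [:: 0; 1; 2; 0; 3; 4; 5; 2; 6; 7; 5; 3; 8; 6; 1; 7; 8; 4];
  [:: 0; 1; 2; 0; 3; 4; 5; 3; 6; 2; 7; 1; 8; 5; 7; 6; 8; 4];
  [:: 0; 1; 2; 0; 3; 4; 5; 6; 1; 4; 3; 7; 2; 8; 7; 5; 8; 6];
  [:: 0; 1; 2; 0; 3; 4; 5; 6; 1; 5; 2; 7; 8; 4; 6; 8; 3; 7];
  [:: 0; 1; 2; 0; 3; 4; 5; 6; 1; 7; 4; 8; 6; 2; 3; 7; 8; 5];
  [:: 0; 1; 2; 0; 3; 4; 5; 6; 1; 7; 5; 2; 3; 7; 8; 4; 6; 8];
  [:: 0; 1; 2; 0; 3; 4; 5; 6; 1; 7; 5; 8; 2; 3; 8; 7; 4; 6];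
  [:: 0; 1; 2; 0; 3; 4; 5; 6; 3; 2; 7; 6; 1; 8; 7; 4; 5; 8];
  [:: 0; 1; 2; 0; 3; 4; 5; 6; 3; 7; 1; 2; 8; 7; 5; 6; 8; 4];
  [:: 0; 1; 2; 0; 3; 4; 5; 6; 4; 2; 7; 1; 8; 6; 7; 3; 8; 5];
  [:: 0; 1; 2; 3; 0; 4; 1; 5; 2; 6; 4; 7; 8; 5; 6; 3; 8; 7];
  [:: 0; 1; 2; 3; 0; 4; 1; 5; 6; 7; 8; 5; 3; 4; 8; 2; 6; 7];
  [:: 0; 1; 2; 3; 0; 4; 5; 2; 1; 6; 5; 7; 8; 6; 3; 4; 8; 7];
  [:: 0; 1; 2; 3; 0; 4; 5; 3; 6; 1; 7; 2; 8; 6; 4; 7; 5; 8];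
  [:: 0; 1; 2; 3; 0; 4; 5; 3; 6; 7; 5; 1; 8; 2; 6; 7; 4; 8];
  [:: 0; 1; 2; 3; 0; 4; 5; 3; 6; 7; 5; 8; 1; 2; 7; 4; 6; 8];
  [:: 0; 1; 2; 3; 0; 4; 5; 3; 6; 7; 8; 5; 1; 6; 2; 8; 4; 7];
  [:: 0; 1; 2; 3; 0; 4; 5; 6; 3; 7; 4; 8; 6; 1; 2; 8; 7; 5];
  [:: 0; 1; 2; 3; 0; 4; 5; 6; 3; 7; 4; 8; 6; 1; 7; 2; 8; 5];
  [:: 0; 1; 2; 3; 0; 4; 5; 6; 7; 4; 3; 1; 8; 6; 7; 2; 8; 5] ].

(** Found by computer search over all graphs with 9 vertices, propagating values from
    the circle graphs through 4-term relations with one unknown term. *)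
Definition base_steps : seq step := [::
  (38, 4, 5, (30, [:: 0; 1; 2; 3; 4; 8; 7; 6; 5]), (102, [:: 0; 1; 2; 3; 4; 6; 5; 8; 7]));
  (55, 2, 6, (65, [:: 0; 2; 1; 7; 8; 6; 4; 5; 3]), (102, [:: 0; 2; 1; 6; 5; 8; 7; 4; 3]));
  (70, 4, 2, (103, [:: 8; 7; 6; 1; 5; 4; 3; 2; 0]), (76, [:: 8; 7; 5; 1; 6; 4; 3; 2; 0]));
  (4, 7, 0, (104, [:: 6; 5; 2; 1; 0; 3; 4; 7; 8]), (66, [:: 7; 4; 2; 1; 0; 3; 5; 6; 8]));
  (50, 1, 8, (25, [:: 7; 8; 5; 3; 6; 2; 4; 0; 1]), (105, [:: 8; 5; 7; 0; 6; 3; 1; 4; 2]));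
  (64, 2, 5, (106, [:: 4; 5; 2; 6; 7; 8; 0; 1; 3]), (77, [:: 0; 2; 1; 3; 4; 5; 8; 6; 7]));
  (79, 6, 8, (23, [:: 5; 2; 6; 4; 8; 3; 7; 0; 1]), (107, [:: 6; 2; 7; 4; 8; 3; 5; 0; 1]));
  (84, 7, 0, (48, [:: 3; 4; 5; 7; 6; 1; 8; 2; 0]), (34, [:: 0; 2; 1; 6; 5; 3; 4; 7; 8]));
  (29, 2, 3, (46, [:: 0; 2; 1; 4; 3; 7; 8; 6; 5]), (109, [:: 8; 7; 5; 2; 0; 4; 3; 6; 1]));
  (7, 5, 0, (92, [:: 0; 1; 3; 4; 6; 2; 5; 8; 7]), (110, [:: 0; 1; 2; 3; 7; 4; 8; 6; 5]));
  (99, 4, 6, (89, [:: 3; 4; 5; 6; 0; 2; 7; 8; 1]), (112, [:: 8; 2; 1; 6; 4; 7; 3; 0; 5]));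
  (96, 2, 4, (112, [:: 4; 7; 5; 3; 6; 0; 2; 1; 8]), (101, [:: 0; 3; 1; 2; 5; 8; 6; 7; 4]));
  (97, 4, 8, (57, [:: 4; 5; 6; 2; 0; 3; 8; 1; 7]), (113, [:: 5; 6; 7; 3; 0; 4; 8; 1; 2]));
  (75, 0, 4, (114, [:: 8; 4; 0; 3; 1; 2; 6; 7; 5]), (115, [:: 0; 6; 7; 8; 5; 4; 1; 2; 3]));
  (111, 0, 7, (115, [:: 1; 3; 8; 2; 5; 0; 4; 6; 7]), (94, [:: 1; 5; 6; 2; 4; 0; 3; 7; 8]));
  (108, 0, 6, (100, [:: 6; 1; 3; 0; 4; 5; 7; 8; 2]), (116, [:: 1; 6; 2; 8; 0; 7; 5; 3; 4]));
  (58, 6, 0, (117, [:: 0; 2; 6; 4; 7; 8; 1; 5; 3]), (82, [:: 0; 2; 1; 4; 8; 6; 7; 3; 5]));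
  (8, 1, 7, (62, [:: 8; 6; 7; 3; 1; 2; 4; 5; 0]), (119, [:: 0; 1; 2; 3; 5; 4; 7; 6; 8]));
  (3, 0, 7, (119, [:: 7; 1; 2; 0; 3; 4; 5; 6; 8]), (63, [:: 5; 6; 7; 8; 4; 2; 1; 3; 0]));
  (69, 2, 5, (120, [:: 2; 4; 3; 5; 1; 6; 7; 8; 0]), (41, [:: 0; 1; 2; 5; 4; 3; 7; 8; 6]));
  (35, 5, 4, (71, [:: 0; 1; 2; 4; 5; 3; 6; 7; 8]), (121, [:: 0; 1; 2; 4; 5; 3; 6; 7; 8]));
  (6, 7, 0, (67, [:: 4; 3; 2; 8; 7; 6; 0; 1; 5]), (122, [:: 0; 1; 2; 4; 7; 6; 5; 3; 8]));
  (59, 1, 8, (123, [:: 8; 5; 7; 6; 0; 3; 1; 4; 2]), (49, [:: 4; 5; 2; 0; 3; 6; 7; 8; 1]));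
  (124, 0, 5, (98, [:: 5; 1; 3; 0; 4; 6; 7; 8; 2]), (115, [:: 3; 4; 8; 7; 6; 0; 1; 2; 5]));
  (117, 1, 5, (118, [:: 8; 6; 1; 0; 7; 3; 5; 4; 2]), (125, [:: 7; 1; 8; 3; 6; 4; 5; 0; 2]));
  (45, 1, 7, (54, [:: 0; 1; 2; 3; 4; 7; 8; 5; 6]), (40, [:: 0; 1; 2; 3; 4; 7; 6; 8; 5]));
  (127, 0, 5, (99, [:: 6; 5; 8; 2; 1; 4; 7; 3; 0]), (112, [:: 6; 5; 8; 2; 1; 4; 7; 3; 0]));
  (5, 6, 0, (61, [:: 7; 6; 4; 5; 1; 2; 8; 3; 0]), (28, [:: 0; 1; 2; 3; 7; 6; 4; 5; 8]));
  (90, 6, 0, (128, [:: 6; 3; 4; 0; 2; 1; 5; 8; 7]), (129, [:: 8; 4; 5; 6; 7; 2; 0; 3; 1]));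
  (130, 0, 4, (93, [:: 0; 6; 7; 1; 2; 4; 3; 5; 8]), (31, [:: 0; 5; 6; 1; 4; 3; 2; 8; 7]));
  (131, 0, 1, (81, [:: 0; 4; 5; 6; 8; 1; 7; 2; 3]), (132, [:: 0; 2; 1; 8; 7; 6; 5; 4; 3]));
  (132, 0, 4, (132, [:: 0; 6; 5; 4; 3; 1; 2; 8; 7]), (95, [:: 7; 2; 1; 8; 6; 5; 4; 0; 3]));
  (88, 4, 8, (133, [:: 0; 6; 2; 1; 3; 8; 5; 7; 4]), (85, [:: 5; 6; 1; 2; 8; 7; 4; 3; 0]));
  (24, 7, 0, (134, [:: 8; 4; 3; 6; 1; 7; 5; 2; 0]), (87, [:: 8; 4; 6; 3; 2; 5; 7; 1; 0]));
  (135, 5, 0, (37, [:: 4; 7; 5; 3; 2; 6; 8; 1; 0]), (32, [:: 4; 5; 6; 3; 2; 8; 7; 1; 0]));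
  (21, 2, 7, (86, [:: 0; 2; 1; 6; 8; 4; 7; 5; 3]), (136, [:: 8; 4; 7; 0; 1; 5; 2; 6; 3]));
  (137, 1, 7, (33, [:: 0; 2; 1; 3; 7; 5; 8; 4; 6]), (36, [:: 0; 2; 1; 4; 7; 6; 5; 3; 8]));
  (10, 3, 7, (72, [:: 8; 3; 7; 6; 2; 1; 4; 5; 0]), (139, [:: 0; 1; 2; 3; 5; 4; 7; 6; 8]));
  (0, 0, 7, (139, [:: 7; 3; 4; 2; 0; 1; 8; 6; 5]), (74, [:: 5; 6; 1; 7; 8; 4; 0; 3; 2]));
  (123, 0, 6, (140, [:: 0; 7; 2; 8; 6; 5; 1; 3; 4]), (1, [:: 0; 1; 2; 3; 4; 5; 6; 7; 8]));
  (15, 3, 8, (19, [:: 2; 3; 0; 1; 8; 5; 4; 6; 7]), (142, [:: 0; 1; 2; 3; 4; 6; 5; 8; 7]));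
  (2, 0, 7, (142, [:: 8; 3; 5; 4; 2; 0; 1; 7; 6]), (73, [:: 4; 6; 1; 5; 7; 8; 3; 0; 2]));
  (143, 4, 0, (47, [:: 3; 5; 7; 6; 2; 0; 1; 4; 8]), (14, [:: 6; 7; 5; 8; 0; 2; 3; 1; 4]));
  (51, 3, 6, (56, [:: 0; 1; 2; 3; 4; 7; 8; 5; 6]), (60, [:: 0; 1; 2; 3; 4; 8; 6; 7; 5]));
  (53, 5, 7, (145, [:: 0; 1; 2; 3; 4; 5; 6; 8; 7]), (52, [:: 0; 1; 2; 3; 4; 6; 5; 7; 8]));
  (83, 5, 6, (140, [:: 6; 2; 8; 4; 5; 3; 7; 1; 0]), (44, [:: 7; 4; 5; 8; 6; 3; 1; 2; 0]));
  (13, 0, 5, (91, [:: 5; 8; 4; 6; 7; 3; 0; 1; 2]), (147, [:: 4; 8; 3; 5; 7; 6; 0; 1; 2]));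
  (43, 5, 7, (27, [:: 4; 1; 5; 2; 3; 0; 6; 7; 8]), (148, [:: 6; 7; 8; 3; 5; 4; 0; 1; 2]));
  (149, 6, 4, (26, [:: 7; 2; 3; 5; 1; 0; 6; 4; 8]), (68, [:: 7; 2; 3; 6; 1; 0; 4; 5; 8]));
  (144, 0, 2, (146, [:: 5; 6; 1; 4; 7; 8; 3; 0; 2]), (150, [:: 7; 5; 1; 4; 6; 8; 3; 0; 2]));
  (138, 8, 4, (141, [:: 8; 7; 5; 2; 6; 1; 0; 3; 4]), (151, [:: 5; 4; 6; 2; 0; 3; 1; 8; 7]));
  (80, 1, 8, (143, [:: 0; 7; 1; 2; 3; 4; 5; 6; 8]), (12, [:: 0; 2; 1; 3; 4; 5; 6; 7; 8]));
  (42, 4, 0, (140, [:: 8; 5; 6; 2; 7; 4; 3; 1; 0]), (9, [:: 8; 6; 7; 3; 2; 5; 4; 1; 0]));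
  (152, 3, 7, (153, [:: 6; 7; 5; 4; 8; 0; 1; 2; 3]), (154, [:: 5; 1; 6; 2; 0; 8; 4; 7; 3]));
  (20, 1, 8, (11, [:: 2; 3; 0; 1; 6; 5; 4; 7; 8]), (156, [:: 0; 1; 2; 3; 4; 6; 5; 8; 7]));
  (16, 1, 6, (156, [:: 2; 3; 0; 1; 5; 7; 8; 4; 6]), (17, [:: 0; 1; 2; 3; 5; 4; 7; 8; 6]));
  (157, 1, 8, (78, [:: 6; 4; 7; 8; 1; 3; 5; 0; 2]), (39, [:: 7; 8; 6; 5; 1; 3; 4; 0; 2]));
  (22, 4, 6, (158, [:: 0; 1; 2; 3; 6; 4; 5; 7; 8]), (18, [:: 0; 1; 2; 3; 7; 4; 5; 6; 8]));
  (152, 7, 0, (155, [:: 2; 3; 0; 1; 4; 8; 6; 7; 5]), (159, [:: 0; 1; 2; 3; 4; 5; 6; 7; 8])) ].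

(** The factor 4 makes the halvings of the chain exact. The last step reaches the
    graph number 126 again. *)
Definition obstruction : option (seq Z) :=
  obind (fun T => table_difference 9 T 126 [:: 4; 6; 5; 8; 7; 3; 1; 2; 0])
    (run_steps 9 (diagram_table 9 (Zpos 4) base_diagrams (trie0 _)) base_steps).

Lemma base_diagrams_on : all (diagram_on 9) base_diagrams.
Proof. by vm_compute. Qed.

(** The whole chain is checked by this evaluation. The coefficients are in the variable 2c and carry
    the scale 4 * 2^9; the trailing zeros are the cancelled top coefficients of polynomials of
    formal degree 9. *)
Lemma obstructionE : obstruction =
  Some [:: Z0; Zpos 18; Zpos 63; Zneg 164; Zpos 64; Z0; Z0; Z0; Z0; Z0].
Proof. by vm_compute. Qed.

Lemma obstruction_factor (K : comNzRingType) (x : K) :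
  2 * x * (18%:R + 2 * x * (63%:R + 2 * x * (- 164%:R + 2 * x * 64%:R)))
  = 4%:R * (x * (8%:R * x - 3%:R) * (x - 1) * (32%:R * x + 3%:R)).
Proof. by ring. Qed.

(** * The equation for [t] forced by an extension *)

Section Obstruction.
Variable R : realType.
Variables (w : {linear diagram_space R -> {poly R[i]}}) (t : R[i]).
Hypothesis hw : is_sl2_weight_system w.

Lemma four_invariant_value_root (gamma : Defs.fgraph -> R[i]) :
  (forall G H, isomorphic G H -> gamma G = gamma H) ->
  (forall n (G : graph_on n) (a b : 'I_n), adj G a b ->
    gamma (fgraph_of G) - gamma (fgraph_of (del_edge G a b))
    = gamma (fgraph_of (slide G a b))
      - gamma (fgraph_of (del_edge (slide G a b) a b))) ->
  (forall D : chord_word,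
    gamma (intersection_graph D) = (w (diagram_vec R D)).[t]) ->
  t * (8%:R * t - 3%:R) * (t - 1) * (32%:R * t + 3%:R) = 0.
Proof.
move=> iso fourT ext.
have memo0 : sound_memo w t (trie0 _) by move=> s P; rewrite trie_find0.
have sound0 := diagram_table_sound hw iso ext (c := Zpos 4) base_diagrams_on memo0.
have := obstructionE; rewrite /obstruction.
case E: (run_steps _ _ _) => [T|//] /=.
move/(table_difference_sound iso (run_steps_sound iso fourT sound0 E)).
move=> root.
suff /eqP : 4%:R * (t * (8%:R * t - 3%:R) * (t - 1) * (32%:R * t + 3%:R)) = 0.
  by rewrite mulf_eq0 pnatr_eq0 /= => /eqP.
rewrite -obstruction_factor -[RHS]root /zpoly_eval /= !(mulr0, addr0, add0r).
by [].
Qed.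

End Obstruction.

Theorem proposition2p1 (R : realType)
    (w : {linear diagram_space R -> {poly R[i]}})
    (hw : is_sl2_weight_system w) :
  [/\
      ~ (exists g : {linear graph_space R -> {poly R[i]}},
           is_four_invariant g /\ extends g w),
      ~ (exists! g : {linear graph_space R -> {poly R[i]}},
           is_four_invariant g /\ extends g w),
      (determined_by_intersection_graph w ->
       ~ (forall (M : lmodType R[i]) (w' : {linear diagram_space R -> M}),
            is_weight_system w' -> determined_by_intersection_graph w' ->
            exists g : {linear graph_space R -> M},
              is_four_invariant g /\ extends g w'))
    &
      forall t : R[i],
        (exists g : {linear graph_space R -> R[i]^o},
           is_four_invariant g /\
           extends g (fun x : diagram_space R => (w x).[t] : R[i]^o)) ->
        t \in [:: 0; 3%:R / 8%:R; 1; - (3%:R / 32%:R)]].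
Proof.
have eight : (8%:R : R[i]) != 0 by rewrite pnatr_eq0.
have thirtytwo : (32%:R : R[i]) != 0 by rewrite pnatr_eq0.
(* Both parts use this: [f] is evaluation at a point for polynomial values and the identity for
   scalar ones. Additivity of [f] is enough to transport the 4-term relation. *)
have root_of (M : lmodType R[i]) (g : {linear graph_space R -> M})
    (w' : diagram_space R -> M) (f : {additive M -> R[i]}) (t : R[i]) :
    is_four_invariant g -> extends g w' ->
    (forall x, f (w' x) = (w x).[t]) ->
    t \in [:: 0; 3%:R / 8%:R; 1; - (3%:R / 32%:R)].
  move=> g4 gw fw.
  pose gamma (G : Defs.fgraph) := f (g << \pi_graph_class G >>).
  have gamma_iso G H : isomorphic G H -> gamma G = gamma H.
    by move=> GH; congr (f (g << _ >>)); apply/eqmodP.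
  have gamma_4T n (G : graph_on n) (a b : 'I_n) : adj G a b ->
      gamma (fgraph_of G) - gamma (fgraph_of (del_edge G a b))
      = gamma (fgraph_of (slide G a b))
        - gamma (fgraph_of (del_edge (slide G a b) a b)).
    by move=> ab; rewrite -!(raddfB f); congr (f _); exact: g4.
  have gamma_ext D : gamma (intersection_graph D) = (w (diagram_vec R D)).[t].
    by rewrite -fw -gw.
  have := four_invariant_value_root hw gamma_iso gamma_4T gamma_ext.
  move=> /eqP; rewrite !mulf_eq0 !inE.
  have solve (a : R[i]) b c : a != 0 -> a * b = c -> b = c / a.
    by move=> a0 <-; rewrite mulrAC divff ?mul1r.
  case/orP=> [/orP[/orP[->//|]|]|].
  - by rewrite subr_eq0 => /eqP/(solve _ _ _ eight) ->; rewrite eqxx orbT.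
  - by rewrite subr_eq0 => ->; rewrite !orbT.
  by rewrite addr_eq0 => /eqP/(solve _ _ _ thirtytwo) ->; rewrite mulNr eqxx !orbT.
have no_ext : ~ (exists g : {linear graph_space R -> {poly R[i]}},
    is_four_invariant g /\ extends g w).
  case=> g [g4 gw].
  (* The point 2 is simply one outside the four admissible values. *)
  have := root_of _ g w (horner_eval (2 : R[i])) 2 g4 gw (fun _ => erefl).
  rewrite !inE => /or4P[] /eqP.
  - by apply/eqP; rewrite pnatr_eq0.
  - by move/(congr1 (fun x => x * 8%:R))/eqP; rewrite divfK // -natrM eqr_nat.
  - by apply/eqP; rewrite (eqr_nat _ 2 1).
  by apply/eqP; rewrite gt_eqF // (@lt_trans _ _ 0) ?ltr0n // oppr_lt0 divr_gt0 ?ltr0n.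
split=> //.
- by case=> g [gP _]; apply: no_ext; exists g.
(* The weight system [w] itself is the counterexample to the general extension claim. *)
- by move=> wd H; apply: no_ext; apply: H => //; case: hw.
by move=> t [g [g4 gw]]; apply: (root_of _ g _ idfun t g4 gw).
Qed.
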